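(* Let $n\geq1$, $r=2^n$ and $M=6^{2^n}+1$. Let $\pi=2+3\zeta_3\in\mathbb{Z}[\zeta_6]$ and $\alpha=\pi/\bar\pi$. Define the sequence $\{S_k\}_{k\ge 0}$ by $S_0=\alpha+\bar\alpha$ and $S_{k+1}=S_k^6-6S_k^4+9S_k^2-2$ for $k\geq0$. Then $M$ is prime if and only if $S_{r-1}\equiv-1\pmod M$.
   Context: $\zeta_m=e^{2\pi\sqrt{-1}/m}$ and a bar denotes complex conjugation. The $S_k$ are rational numbers with denominators prime to $M$; the congruence modulo $M$ is understood in the ring of rationals with denominator prime to $M$. *)

(* Defs.v *)
From mathcomp Require Import all_boot all_order all_algebra.
From mathcomp Require Import all_classical all_reals all_analysis.
From mathcomp Require Import complex.

Set Implicit Arguments.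
Unset Strict Implicit.
Unset Printing Implicit Defensive.

Import Order.TTheory GRing.Theory Num.Theory.
Local Open Scope ring_scope.
Local Open Scope complex_scope.

Section LucasSequence.
Variable R : realType.

(* e ^ (2 pi sqrt(-1) / m), written out by Euler's formula since the library
   has no complex exponential. *)
Definition zeta (m : nat) : R[i] :=
  cos (2 * pi / m%:R) +i* sin (2 * pi / m%:R).

(* The element 2 + 3 zeta_3 usually written pi; that name denotes the real
   number pi in the library. *)
Definition varpi : R[i] := 2 + 3 * zeta 3.

Definition alpha : R[i] := varpi / varpi^*.

Fixpoint Sseq (k : nat) : R[i] :=
  if k is j.+1 then Sseq j ^+ 6 - 6 * Sseq j ^+ 4 + 9 * Sseq j ^+ 2 - 2
  else alpha + alpha^*.

End LucasSequence.

Definition localZ (M : nat) (x : rat) : bool := coprimez (denq x) M.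

(* Congruence modulo the ideal generated by M in the ring localZ M. *)
Definition eqmod_local (M : nat) (x y : rat) : Prop :=
  [/\ localZ M x, localZ M y & exists2 c, localZ M c & x - y = M%:R * c].

(* Main.v *)
(* With w a primitive cube root of unity, S_k = a^(6^k) + a^-(6^k) for
   a = (2 + 3 w) / (2 + 3 w^-1), since the recursion is the Dickson polynomial
   D_6. Hence, 6^(r-1) being (M - 1) / 6, the congruence says that a^((M-1)/6)
   is a primitive cube root of unity modulo every prime factor of M.
   If so, a has order divisible by 3^r modulo a prime q | M; but a^(q-1) = 1 or
   a^(q+1) = 1 because a + a^-1 is rational, so q >= 3^r - 1 > sqrt M.
   If M is a prime p, then p = 2 mod 7, and the values of the cubic and of the
   quadratic characters at a are read off the action of the Frobenius on the
   cubic and quadratic Gauss sums of conductor 7 in characteristic p. *)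
Require Import Defs.
From mathcomp Require Import all_boot all_order all_algebra all_field.
From mathcomp Require Import all_classical all_reals all_analysis.
From mathcomp Require Import complex.
From mathcomp Require Import ring lra zify.

Set Implicit Arguments.
Unset Strict Implicit.
Unset Printing Implicit Defensive.

Import Order.TTheory GRing.Theory Num.Theory.
Local Open Scope ring_scope.

(* The numerator of S_k over 7^(6^k). *)
Fixpoint Snum (k : nat) : int :=
  if k is j.+1 then
    let d := 7 ^+ (6 ^ j) in
    Snum j ^+ 6 - 6 * Snum j ^+ 4 * d ^+ 2 + 9 * Snum j ^+ 2 * d ^+ 4 - 2 * d ^+ 6
  else -13.

Lemma dickson6 (F : fieldType) (x : F) : x != 0 ->
  let t := x + x^-1 in
  t ^+ 6 - 6 * t ^+ 4 + 9 * t ^+ 2 - 2 = x ^+ 6 + x ^- 6.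
Proof. by move=> x0 /=; field. Qed.

(* -1 - 3 w is the conjugate 2 + 3 w^2. *)
Definition eisenstein_ratio (F : fieldType) (w : F) : F :=
  (2 + 3 * w) / (-1 - 3 * w).

(** * The ratio a and the sequence over an arbitrary field *)

Section EisensteinRatio.

Variables (F : fieldType) (w : F).
Hypothesis w2E : w ^+ 2 = - w - 1.
Hypothesis F7 : 7 != 0 :> F.

Let a := eisenstein_ratio w.

Lemma eisenstein_norm : (2 + 3 * w) * (-1 - 3 * w) = 7.
Proof. by ring: w2E. Qed.

Lemma eisenstein_neq0 : (2 + 3 * w != 0) && (-1 - 3 * w != 0).
Proof. by rewrite -negb_or -mulf_eq0 eisenstein_norm. Qed.

Lemma eisenstein_ratio_neq0 : a != 0.
Proof.
by have /andP[n1 n2] := eisenstein_neq0; rewrite mulf_neq0 ?invr_eq0.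
Qed.

(** The two conjugates have sum 1 and product 7, so their squares add up to 1 - 14; hence the
    initial value of [Snum]. *)
Lemma eisenstein_ratio_trace : 7 * (a + a^-1) = -13.
Proof.
have /andP[n1 n2] := eisenstein_neq0.
rewrite -eisenstein_norm /a /eisenstein_ratio.
have -> : (2 + 3 * w) * (-1 - 3 * w) *
    ((2 + 3 * w) / (-1 - 3 * w) + ((2 + 3 * w) / (-1 - 3 * w))^-1)
  = (2 + 3 * w) ^+ 2 + (-1 - 3 * w) ^+ 2 by field; rewrite n1 n2.
by ring: w2E.
Qed.

Lemma Snum_eisenstein k :
  (Snum k)%:~R = 7 ^+ (6 ^ k) * (a ^+ (6 ^ k) + a ^- (6 ^ k)).
Proof.
elim: k => [|k IHk]; first by rewrite expn0 !expr1 eisenstein_ratio_trace.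
rewrite expnSr !exprM /= !(rmorphB, rmorphD, rmorphM, rmorphXn) /= IHk.
have x0 : a ^+ (6 ^ k) != 0 by rewrite expf_neq0 ?eisenstein_ratio_neq0.
rewrite -(dickson6 x0).
by set x := a ^+ _; set y := x^-1; set d := 7 ^+ _; ring.
Qed.

(** With x = a^(6^k), x + 1/x + 1 is (x^2 + x + 1)/x, so S_k = -1 says that x is a root of the third
    cyclotomic polynomial. *)
Lemma Snum_eq_opp k :
  ((Snum k + 7 ^+ (6 ^ k))%:~R == 0 :> F)
    = (a ^+ (6 ^ k) ^+ 2 + a ^+ (6 ^ k) + 1 == 0).
Proof.
have x0 : a ^+ (6 ^ k) != 0 by rewrite expf_neq0 ?eisenstein_ratio_neq0.
rewrite rmorphD /= Snum_eisenstein rmorphXn /=.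
move: x0; set x := a ^+ _ => x0.
have -> : 7 ^+ (6 ^ k) * (x + x^-1) + 7 ^+ (6 ^ k)
   = 7 ^+ (6 ^ k) / x * (x ^+ 2 + x + 1) by field.
by rewrite !mulf_eq0 invr_eq0 expf_eq0 (negPf F7) andbF (negPf x0).
Qed.

End EisensteinRatio.

(** * Orders of elements in characteristic p *)

Lemma pchar_prime_neq0 (F : fieldType) (p m : nat) :
  p \in [pchar F] -> prime m -> p != m -> m%:R != 0 :> F.
Proof.
move=> pcharFp m_pr; apply: contra.
by rewrite -(dvdn_pcharf pcharFp) dvdn_prime2 // (pcharf_prime pcharFp).
Qed.

Section Frobenius.

Variables (F : fieldType) (p : nat) (w : F).
Hypothesis pcharFp : p \in [pchar F].
Hypothesis w2E : w ^+ 2 = - w - 1.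
Hypothesis F7 : 7 != 0 :> F.

Let a := eisenstein_ratio w.

(** The trace a + 1/a lies in the prime field, so Frobenius permutes the roots a and 1/a of X^2 - (a
    + 1/a) X + 1. *)
Lemma eisenstein_ratio_Frobenius : a ^+ p.-1 = 1 \/ a ^+ p.+1 = 1.
Proof.
have a0 : a != 0 by apply: eisenstein_ratio_neq0.
have tr : a + a^-1 = a ^+ p + a ^- p.
  have E := eisenstein_ratio_trace w2E F7.
  apply: (mulfI F7); rewrite [LHS]E.
  have := congr1 (pFrobenius_aut pcharFp) E.
  rewrite rmorphM rmorphN !rmorph_nat => <-.
  by rewrite (rmorphD _ a) /= !pFrobenius_autE exprVn.
have p0 : (0 < p)%N by apply: prime_gt0 (pcharf_prime pcharFp).
have ap0 : a ^+ p != 0 by rewrite expf_neq0.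
have : (a ^+ p - a) * (a ^+ p * a - 1) = 0.
  have -> : (a ^+ p - a) * (a ^+ p * a - 1)
    = ((a ^+ p + a ^- p) - (a + a^-1)) * (a ^+ p * a) by field; rewrite a0.
  by rewrite -tr subrr mul0r.
move/eqP; rewrite mulf_eq0 !subr_eq0 => /orP[] /eqP h; [left|right].
  by apply: (mulfI a0); rewrite -exprS prednK // mulr1.
by rewrite exprSr.
Qed.

End Frobenius.

Lemma order_lower_bound (F : fieldType) (x : F) (s m : nat) : (0 < s)%N ->
  (3 != 0 :> F) -> (x ^+ (6 ^ s.-1)) ^+ 2 + x ^+ (6 ^ s.-1) + 1 = 0 ->
  x ^+ m = 1 -> (3 ^ s %| m)%N.
Proof.
case: s => // s _ F3 /=; set u := x ^+ _ => hu xm.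
have u3 : u ^+ 3 = 1.
  apply/eqP; rewrite -subr_eq0; apply/eqP.
  by rewrite -[RHS](mulr0 (u - 1)) -hu; ring.
have u1 : u != 1.
  apply: contra F3 => /eqP u1; rewrite -hu u1 expr1n.
  by apply/eqP; ring.
(* Here [s] is already the predecessor. Raising to 2^s leaves an element with y^(3^s) = u of order
   3, so y has order exactly 3^(s+1). *)
pose y := x ^+ (2 ^ s).
have uE : u = y ^+ (3 ^ s) by rewrite -exprM -expnMn.
have y1 : y ^+ (3 ^ s.+1) = 1 by rewrite expnSr exprM -uE.
have [d prd /dvdn_pfactor] :=
  prim_order_exists (expn_gt0 3 _ : (0 < 3 ^ s.+1)%N) y1.
move=> /(_ isT) [e le_es dE].
have es : (e == s.+1)%N.
  apply: contraNT u1 => ne; rewrite uE -(prim_order_dvd prd) dE.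
  by rewrite dvdn_exp2l // -ltnS ltn_neqAle ne.
rewrite -(eqP es) -dE (prim_order_dvd prd).
by rewrite /y exprAC xm expr1n.
Qed.

Lemma closure_eisenstein (p : nat) : prime p ->
  {F : closedFieldType & {w : F | p \in [pchar F] & w ^+ 2 = - w - 1}}.
Proof.
move=> p_pr; have [F [f _]] := countable_algebraic_closure 'F_p.
exists F; have [w wE] : {w : F | w ^+ 2 == - w - 1}.
  apply: sigW.
  (* With all lower coefficients -1, the equation solved is w^2 = -1 - w. *)
  have [w wE] := @solve_monicpoly F 2 (fun=> -1) isT.
  by exists w; rewrite wE !big_ord_recl big_ord0 /=; apply/eqP; ring.
exists w; last exact/eqP.
by apply: (rmorph_pchar f); apply: pchar_Fp.
Qed.

(** * Gauss sums of conductor 7 and the characters of a *)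

(** The sum of chi(t) z^t over t mod 7, for the cubic character with chi(3) = w. *)
Definition cubic_gauss_sum (F : fieldType) (w z : F) : F :=
  z + z ^+ 6 + w * (z ^+ 3 + z ^+ 4) + w ^+ 2 * (z ^+ 2 + z ^+ 5).

Definition quadratic_gauss_sum (F : fieldType) (z : F) : F :=
  z + z ^+ 2 + z ^+ 4 - z ^+ 3 - z ^+ 5 - z ^+ 6.

Section GaussSums.

Variables (F : fieldType) (w z : F).
Hypothesis w2E : w ^+ 2 = - w - 1.
Hypothesis z6E : z ^+ 6 = - (1 + z + z ^+ 2 + z ^+ 3 + z ^+ 4 + z ^+ 5).

(** This is g^3 = 7 J(chi, chi), with Jacobi sum J(chi, chi) = 2 + 3 w^2 = -1 - 3 w. *)
Lemma cubic_gauss_sum_cube :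
  cubic_gauss_sum w z ^+ 3 = 7 * (-1 - 3 * w).
Proof. by rewrite /cubic_gauss_sum; ring: w2E z6E. Qed.

(** The factor is the inverse of chi(2) = w^2. *)
Lemma cubic_gauss_sum_twist :
  cubic_gauss_sum w (z ^+ 2) = w * cubic_gauss_sum w z.
Proof. by rewrite /cubic_gauss_sum; ring: w2E z6E. Qed.

Lemma quadratic_gauss_sum_square : quadratic_gauss_sum z ^+ 2 = - 7.
Proof. by rewrite /quadratic_gauss_sum; ring: z6E. Qed.

(** 2 is a square modulo 7. *)
Lemma quadratic_gauss_sum_twist :
  quadratic_gauss_sum (z ^+ 2) = quadratic_gauss_sum z.
Proof. by rewrite /quadratic_gauss_sum; ring: z6E. Qed.

Variable p : nat.
Hypothesis pcharFp : p \in [pchar F].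

Lemma cubic_gauss_sum_Frobenius :
  cubic_gauss_sum w z ^+ p = cubic_gauss_sum (w ^+ p) (z ^+ p).
Proof.
rewrite -!(pFrobenius_autE pcharFp) /cubic_gauss_sum.
by rewrite !(rmorphD, rmorphM, rmorphXn).
Qed.

Lemma quadratic_gauss_sum_Frobenius :
  quadratic_gauss_sum z ^+ p = quadratic_gauss_sum (z ^+ p).
Proof.
rewrite -!(pFrobenius_autE pcharFp) /quadratic_gauss_sum.
by rewrite !(rmorphB, rmorphD, rmorphXn).
Qed.

Variables (k : nat).
Hypothesis pE : p = (12 * k).+1.
Hypothesis p7 : (p %% 7 = 2)%N.

Let F7 : 7 != 0 :> F.
Proof.
apply: (pchar_prime_neq0 (m := 7) pcharFp) => //.
by apply: contra_eqN p7 => /eqP ->.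
Qed.

Let wp : w ^+ p = w.
Proof.
have w3 : w ^+ 3 = 1 by ring: w2E.
by rewrite pE exprS (_ : 12 * k = 3 * (4 * k))%N ?exprM ?w3 ?expr1n ?mulr1 //; lia.
Qed.

Let zp : z ^+ p = z ^+ 2.
Proof.
have z7 : z ^+ 7 = 1 by ring: z6E.
by rewrite (divn_eq p 7) p7 exprD mulnC exprM z7 expr1n mul1r.
Qed.

Let a := eisenstein_ratio w.

Let expr12_1 (x : F) : x != 0 -> x ^+ p = x -> x ^+ (12 * k) = 1.
Proof. by move=> x0 xp; apply: (mulfI x0); rewrite -exprS -pE xp mulr1. Qed.

Let linear_Frobenius (m n : F) : m ^+ p = m -> n ^+ p = n ->
  (m + n * w) ^+ p = m + n * w.
Proof.
rewrite -!(pFrobenius_autE pcharFp) => hm hn.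
by rewrite rmorphD rmorphM /= hm hn pFrobenius_autE wp.
Qed.

Let nat_Frobenius (m : nat) : m%:R ^+ p = m%:R :> F.
Proof. by rewrite -(pFrobenius_autE pcharFp) rmorph_nat. Qed.

(* The cubic Gauss sum is an eigenvector of the Frobenius with eigenvalue w, and
   its cube is a times the cube of the F_p-rational element -1 - 3 w. *)
Lemma eisenstein_ratio_cubic_character : a ^+ (4 * k) = w.
Proof.
have /andP[n1 n2] := eisenstein_neq0 w2E F7.
pose g := cubic_gauss_sum w z.
have g3 : g ^+ 3 = (-1 - 3 * w) ^+ 3 * a.
  rewrite /g cubic_gauss_sum_cube -(eisenstein_norm w2E) /a /eisenstein_ratio.
  by field.
have g0 : g != 0.
  have: g ^+ 3 != 0 by rewrite g3 mulf_neq0 ?expf_neq0 ?eisenstein_ratio_neq0.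
  by rewrite expf_eq0.
have : g ^+ (12 * k) = w.
  apply: (mulfI g0); rewrite -exprS -pE /g cubic_gauss_sum_Frobenius wp zp.
  by rewrite cubic_gauss_sum_twist mulrC.
have kE : (12 * k = 3 * (4 * k))%N by lia.
(* The factor (-1 - 3 w)^(12 k) is 1, since Frobenius fixes w; what is left of g^(12 k) is a^(4
   k). *)
rewrite {1}kE exprM g3 exprMn -exprM -kE expr12_1 ?mul1r //.
have -> : -1 - 3 * w = - (1%:R + 3%:R * w) by ring.
by rewrite -(pFrobenius_autE pcharFp) rmorphN /= pFrobenius_autE linear_Frobenius.
Qed.

(** Since a is (2 + 3 w)^2 / 7, it suffices that 7^(6 k) = 1. Frobenius fixes the quadratic Gauss
    sum, a square root of -7, and the sign disappears because 6 k is even. *)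
Lemma eisenstein_ratio_quadratic_character : a ^+ (6 * k) = 1.
Proof.
have /andP[n1 n2] := eisenstein_neq0 w2E F7.
have aE : a = (2 + 3 * w) ^+ 2 / 7.
  rewrite -(eisenstein_norm w2E) /a /eisenstein_ratio.
  by field; rewrite n1 n2.
pose t := quadratic_gauss_sum z.
have t2 : t ^+ 2 = -7 by apply: quadratic_gauss_sum_square.
have t0 : t != 0.
  have: t ^+ 2 != 0 by rewrite t2 oppr_eq0.
  by rewrite expf_eq0.
have kE : (12 * k = 2 * (6 * k))%N by lia.
have s7 : 7 ^+ (6 * k) = 1 :> F.
  have := expr12_1 t0; rewrite quadratic_gauss_sum_Frobenius zp.
  rewrite quadratic_gauss_sum_twist => /(_ erefl).
  rewrite kE exprM t2 exprNn (_ : 6 * k = 2 * (3 * k))%N; last by lia.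
  by rewrite exprM sqrrN expr1n expr1n mul1r.
rewrite aE exprMn -exprM -kE exprVn s7 invr1 mulr1 expr12_1 //.
exact: linear_Frobenius.
Qed.

(** From u^2 = w and u^3 = 1 follows u = 1/w = -1 - w, the other primitive cube root of unity. *)
Lemma eisenstein_ratio_sextic_character :
  (a ^+ (2 * k)) ^+ 2 + a ^+ (2 * k) + 1 = 0.
Proof.
set u := a ^+ _.
have u2 : u ^+ 2 = w.
  by rewrite -exprM -eisenstein_ratio_cubic_character; congr (_ ^+ _); lia.
have u3 : u ^+ 3 = 1.
  by rewrite -exprM -eisenstein_ratio_quadratic_character; congr (_ ^+ _); lia.
have uw : u * w = 1 by rewrite -u2 -exprS.
have -> : u = u * w * (- 1 - w).
  by rewrite -mulrA -[LHS]mulr1; congr (_ * _); ring: w2E.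
by rewrite uw; ring: w2E.
Qed.

End GaussSums.

(** * Both directions as divisibility of integers *)

Lemma closure_eisenstein7 (p : nat) : prime p ->
  {F : closedFieldType & {w : F & {z : F | p \in [pchar F] &
   w ^+ 2 = - w - 1 /\ z ^+ 6 = - (1 + z + z ^+ 2 + z ^+ 3 + z ^+ 4 + z ^+ 5)}}}.
Proof.
move=> p_pr; have [F [w charF wE]] := closure_eisenstein p_pr.
exists F, w.
have [z zE] : {z : F | z ^+ 6 == - (1 + z + z ^+ 2 + z ^+ 3 + z ^+ 4 + z ^+ 5)}.
  apply: sigW.
  have [z zE] := @solve_monicpoly F 6 (fun=> -1) isT.
  by exists z; rewrite zE !big_ord_recl big_ord0 /=; apply/eqP; ring.
by exists z => //; split=> //; apply/eqP.
Qed.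

Lemma even_gt0E (r : nat) : ~~ odd r -> (0 < r)%N -> exists h, r = (h.+1 * 2)%N.
Proof.
move=> r_even r_gt0; exists (r./2).-1; rewrite prednK ?muln2 ?even_halfK //.
by case: r r_even r_gt0 => [|[]].
Qed.

Lemma prime_dvd_Snum (r : nat) : ~~ odd r -> (0 < r)%N -> prime (6 ^ r + 1) ->
  ((6 ^ r + 1)%N %| Snum r.-1 + 7 ^+ (6 ^ r.-1))%Z.
Proof.
move=> r_even r_gt0; set p := (6 ^ r + 1)%N => p_pr.
have [F [w [z charF [wE zE]]]] := closure_eisenstein7 p_pr.
have [h rE] := even_gt0E r_even r_gt0.
(* As r = 2 (h + 1), p - 1 = 36^(h+1); moreover 36 = 1 mod 7. *)
have pE : p = (12 * (3 * 36 ^ h)).+1.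
  by rewrite /p rE mulnC expnM expnS -[(6 ^ 2)%N]/36%N; lia.
have p7 : (p %% 7 = 2)%N.
  by rewrite /p rE mulnC expnM -modnDml -modnXm exp1n.
have F7 : 7 != 0 :> F.
  apply: (pchar_prime_neq0 (m := 7) charF) => //.
  by apply: contra_eqN p7 => /eqP ->.
rewrite (dvdz_pcharf charF) (Snum_eq_opp wE) //.
have -> : (6 ^ r.-1 = 2 * (3 * 36 ^ h))%N.
  by rewrite rE mulSn /= expnS (mulnC h) expnM -[(6 ^ 2)%N]/36%N; lia.
by rewrite (eisenstein_ratio_sextic_character wE zE charF).
Qed.

Lemma dvd_Snum_prime (r : nat) : ~~ odd r -> (0 < r)%N ->
  ((6 ^ r + 1)%N %| Snum r.-1 + 7 ^+ (6 ^ r.-1))%Z -> prime (6 ^ r + 1).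
Proof.
move=> r_even r_gt0 dvdM; set M := (6 ^ r + 1)%N in dvdM *.
have [h rE] := even_gt0E r_even r_gt0.
have M_gt1 : (1 < M)%N by rewrite /M addn1 ltnS expn_gt0.
have M7 : (M %% 7 = 2)%N by rewrite /M rE mulnC expnM -modnDml -modnXm exp1n.
have M3 : (M %% 3 = 1)%N by rewrite /M rE mulnC expnM -modnDml -modnXm exp0n.
apply: contraT => Mnprime.
have q_pr := pdiv_prime M_gt1; set q := pdiv M in q_pr.
have qM : (q %| M)%N := pdiv_dvd M.
have q2 : (q ^ 2 <= M)%N.
  by rewrite leqNgt; apply: contra Mnprime; apply: ltn_pdiv2_prime; lia.
have [F [w charF wE]] := closure_eisenstein q_pr.
have Fnat m : prime m -> (M %% m != 0)%N -> m%:R != 0 :> F.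
  move=> m_pr Mm; apply: pchar_prime_neq0 charF m_pr _.
  by apply: contra Mm => /eqP <-.
have F7 : 7 != 0 :> F by apply: (Fnat 7); rewrite ?M7.
have F3 : 3 != 0 :> F by apply: (Fnat 3); rewrite ?M3.
have : (q %| Snum r.-1 + 7 ^+ (6 ^ r.-1))%Z.
  by apply: dvdz_trans dvdM.
rewrite (dvdz_pcharf charF) (Snum_eq_opp wE) // => /eqP hu.
(* 3^r divides q - 1 or q + 1, both positive. *)
have : (3 ^ r <= q.+1)%N.
  have ord m : _ ^+ m = 1 -> _ := order_lower_bound r_gt0 F3 hu.
  have := prime_gt1 q_pr.
  by case: (eisenstein_ratio_Frobenius charF wE F7) => /ord /dvdn_leq; lia.
have t2s : (9 * 2 ^ r <= 4 * 3 ^ r)%N.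
  rewrite rE (mulnC h.+1) !(expnM _ 2) !(expnS (_ ^ 2)).
  rewrite -[(2 ^ 2)%N]/4%N -[(3 ^ 2)%N]/9%N.
  have : (4 ^ h <= 9 ^ h)%N by case: (h) => // h'; rewrite leq_exp2r.
  by lia.
have Me : M = (2 ^ r * 3 ^ r + 1)%N by rewrite -expnMn.
have : (4 <= 2 ^ r)%N by rewrite rE mulnC expnM expnS leq_pmulr ?expn_gt0.
(* With s = 2^r and t = 3^r, (t - 1)^2 <= q^2 <= s t + 1 gives t <= s + 2, against t >= 9 s / 4 and
   s >= 4. *)
move: q2; rewrite Me; move: (2 ^ r)%N (3 ^ r)%N t2s => s t.
by nia.
Qed.

(** * The sequence in the complex numbers *)

Lemma cos_2pi3 (R : realType) : cos (2 * pi / 3%:R) = - 2^-1 :> R.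
Proof.
have pi0 : 0 < pi :> R := pi_gt0 R.
have c0 : 0 < cos (pi / 3%:R) :> R by apply: cos_gt0_pihalf; lra.
have E : 2 * pi / 3%:R = pi / 3%:R *+ 2 :> R by rewrite mulr2n; field.
have E' : 2 * pi / 3%:R = pi - pi / 3%:R :> R by field.
have h1 := cos_mulr2n (pi / 3%:R : R).
have h2 : cos (2 * pi / 3%:R) = - cos (pi / 3%:R) :> R.
  by rewrite E' addrC cosDpi cosN.
rewrite -E h2 in h1; rewrite h2; move: h1; set c := cos _ => h1.
(* Doubling pi/3 and reflecting it in pi/2 give the same angle; positivity of c then excludes the
   root -1. *)
have : (c + 1) * (2 * c - 1) = 0.
  have -> : (c + 1) * (2 * c - 1) = (c ^+ 2 *+ 2 - 1) - (- c) by ring.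
  by rewrite -h1 subrr.
by move/eqP; rewrite mulf_eq0 => /orP[] /eqP; rewrite /c; lra.
Qed.

Lemma zeta3_sqr (R : realType) : zeta R 3 ^+ 2 = - zeta R 3 - 1.
Proof.
have := cos2Dsin2 (2 * pi / 3%:R : R); rewrite /zeta cos_2pi3.
set s := sin _ => hs; rewrite expr2; apply/eqP; rewrite eq_complex /=.
apply/andP; split; apply/eqP; last by rewrite subr0; field.
have -> : s * s = 1 - (- 2^-1) ^+ 2 by move: hs; rewrite -expr2; lra.
by field.
Qed.

Lemma conj_zeta3 (R : realType) : (zeta R 3)^* = -1 - zeta R 3.
Proof.
apply/eqP; rewrite /zeta eq_complex /= cos_2pi3 oppr0 add0r eqxx andbT.
by apply/eqP; field.
Qed.

Section ComplexSequence.

Variable R : realType.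

Lemma conj_varpi : (varpi R)^* = -1 - 3 * zeta R 3.
Proof.
by rewrite /varpi rmorphD rmorphM /= conj_zeta3 !rmorph_nat; ring.
Qed.

Lemma alphaE : alpha R = eisenstein_ratio (zeta R 3).
Proof. by rewrite /alpha conj_varpi. Qed.

Lemma conj_alpha : (alpha R)^* = (alpha R)^-1.
Proof. by rewrite /alpha rmorphM fmorphV /= conjCK invf_div mulrC. Qed.

Lemma SseqE k : Sseq R k = alpha R ^+ (6 ^ k) + alpha R ^- (6 ^ k).
Proof.
elim: k => [|k IHk]; first by rewrite expn0 !expr1 -conj_alpha.
rewrite expnSr !exprM /= IHk; apply: dickson6.
by rewrite alphaE expf_neq0 ?eisenstein_ratio_neq0 ?zeta3_sqr ?pnatr_eq0.
Qed.

Lemma Sseq_ratr k : Sseq R k = ratr ((Snum k)%:~R / 7 ^+ (6 ^ k)).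
Proof.
have R7 : 7 != 0 :> R[i] by rewrite pnatr_eq0.
rewrite fmorph_div /= ratr_int rmorphXn /= rmorph_nat.
by rewrite (Snum_eisenstein (zeta3_sqr R) R7) -alphaE -SseqE mulrC mulKf // expf_neq0.
Qed.

End ComplexSequence.

(** * Congruences between rationals, and the conclusion *)

Lemma localZ_div (M : nat) (m d : int) : d != 0 -> coprimez d M ->
  localZ M (m%:~R / d%:~R).
Proof.
move=> d0; case: divqP d0 => [?|k x k0 _]; first by rewrite eqxx.
by rewrite coprimezMl => /andP[].
Qed.

Lemma eqmod_local_div (M : nat) (m d : int) : d != 0 -> coprimez d M ->
  eqmod_local M (m%:~R / d%:~R) (-1) <-> (M %| m + d)%Z.
Proof.
move=> d0 dM; have d0Q : d%:~R != 0 :> rat by rewrite intq_eq0.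
split=> [[_ _ [c cM cE]] | /dvdzP[e eE]].
  have : ((m + d) * denq c)%:~R = (M%:Z * (numq c * d))%:~R :> rat.
    rewrite !intrM numqE intrD.
    have -> : (m%:~R + d%:~R : rat) = (m%:~R / d%:~R - -1) * d%:~R by field.
    by rewrite cE; ring.
  move/intr_inj => E.
  (* Clearing both denominators leaves the factor [denq c], which is prime to M and can be
     cancelled. *)
  have : (M %| (m + d) * denq c)%Z by rewrite E dvdz_mulr.
  by rewrite Gauss_dvdzl // coprimez_sym.
split; [exact: localZ_div | by rewrite /localZ denqN coprimezE coprime1n | ].
exists (e%:~R / d%:~R); first exact: localZ_div.
have -> : m = e * M - d by rewrite -eE addrK.
by rewrite rmorphB rmorphM /=; field.
Qed.

Theorem proposition4p1 (R : realType) (n : nat) (hn : (1 <= n)%N) :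
  let r := (2 ^ n)%N in
  let M := (6 ^ (2 ^ n) + 1)%N in
  prime M <-> exists2 s : rat, Sseq R (r - 1) = ratr s & eqmod_local M s (-1).
Proof.
move=> r M.
have r_even : ~~ odd r by rewrite /r -(prednK hn) expnS oddM.
have r_gt0 : (0 < r)%N by rewrite expn_gt0.
have M7 : coprimez (7 ^+ (6 ^ r.-1)) M.
  apply: coprimezXl; rewrite coprimezE /= prime_coprime // /dvdn.
  by rewrite /M -(prednK hn) expnS expnM -modnDml -modnXm exp1n.
rewrite subn1; have dvdE := @eqmod_local_div M (Snum r.-1) _ _ M7.
rewrite rmorphXn /= in dvdE.
split=> [M_pr | [s]].
  exists ((Snum r.-1)%:~R / 7 ^+ (6 ^ r.-1)); first exact: Sseq_ratr.
  apply/dvdE; first by rewrite expf_neq0.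
  exact: prime_dvd_Snum.
(* Injectivity of [ratr] identifies the given rational with [Snum] over a power of 7. *)
rewrite Sseq_ratr => /fmorph_inj <- /dvdE dvdM.
by apply: dvd_Snum_prime => //; apply: dvdM; rewrite expf_neq0.
Qed.
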